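(* Let $G:\mathbb{R}^2\to\mathbb{R}^2$ be a continuous nondegenerate strongly piecewise linear map, i.e. $G$ is continuous and there are a decomposition of $\mathbb{R}^2$ into closed cones $C_1,\ldots,C_n$ with nonempty interior and common vertex at the origin, and linear maps $L_1,\ldots,L_n:\mathbb{R}^2\to\mathbb{R}^2$ such that $G(x)=L_ix$ for all $x\in C_i$, $i=1,\ldots,n$, and the determinants $\det L_1,\ldots,\det L_n$ are all nonzero and have the same sign. Assume that one of the following conditions holds: (1) $n\in\{1,2,3\}$; (2) $n=4$ and all the cones $C_1,\ldots,C_4$ are convex. Then $G$ is invertible and its inverse is a continuous piecewise linear map.
   Context: A closed cone in $\mathbb{R}^2$ with vertex at the origin and nonempty interior means here either $\mathbb{R}^2$ itself or a closed angular sector $\{(\rho\cos\theta,\rho\sin\theta):\rho\ge 0,\ \alpha\le\theta\le\beta\}$ with $0<\beta-\alpha<2\pi$; such a sector need not be convex. A decomposition of $\mathbb{R}^2$ into cones $C_1,\ldots,C_n$ means that their union is $\mathbb{R}^2$ and their interiors are pairwise disjoint. A map $f:\mathbb{R}^2\to\mathbb{R}^2$ is piecewise linear if it is continuous and there are finitely many linear maps $f_1,\ldots,f_\ell$ such that for every $x$ one has $f(x)=f_i(x)$ for some $i$. *)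

(* Defs.v *)
From mathcomp Require Import all_boot all_order all_algebra.
From mathcomp Require Import all_classical all_reals all_analysis.
Set Implicit Arguments.
Unset Strict Implicit.
Unset Printing Implicit Defensive.
Import Order.TTheory GRing.Theory Num.Theory.
Import numFieldNormedType.Exports.
Local Open Scope classical_set_scope.
Local Open Scope ring_scope.

(* The plane is 'cV[R]_2, with R an arbitrary model of the real numbers; linear
   maps of the plane are the maps x |-> A *m x, for A : 'M[R]_2. *)

Definition polar (R : realType) (rho theta : R) : 'cV[R]_2 :=
  \col_i (if i == 0 then rho * cos theta else rho * sin theta).

Definition sector (R : realType) (alpha beta : R) : set 'cV[R]_2 :=
  [set x | exists rho theta : R,
     [/\ 0 <= rho, alpha <= theta <= beta & x = polar rho theta]].

Definition closed_cone (R : realType) (C : set 'cV[R]_2) : Prop :=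
  C = setT \/
  exists alpha beta : R, 0 < beta - alpha < 2 * pi /\ C = sector alpha beta.

Definition cone_decomposition (R : realType) (n : nat)
    (C : 'I_n -> set 'cV[R]_2) : Prop :=
  [/\ forall i, closed_cone (C i),
      \bigcup_i C i = setT &
      forall i j, i != j -> (C i)° `&` (C j)° = set0].

(* The two clauses on the determinants are the nondegeneracy requirement. *)
Definition nondegenerate_strongly_piecewise_linear (R : realType) (n : nat)
    (C : 'I_n -> set 'cV[R]_2) (L : 'I_n -> 'M[R]_2)
    (G : 'cV[R]_2 -> 'cV[R]_2) : Prop :=
  [/\ continuous G,
      cone_decomposition C,
      forall i x, C i x -> G x = L i *m x,
      forall i, \det (L i) != 0 &
      forall i j, Num.sg (\det (L i)) = Num.sg (\det (L j))].

Definition piecewise_linear (R : realType) (f : 'cV[R]_2 -> 'cV[R]_2) : Prop :=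
  continuous f /\
  exists (l : nat) (F : 'I_l -> 'M[R]_2), forall x, exists i, f x = F i *m x.

(* Main.v *)
(* Let a_i be the initial ray of the cone C_i, counterclockwise. The half-open
   sectors [a_i, a_(next i)) partition the punctured plane, and when all
   determinants are positive L_i maps [a_i, a_(next i)) onto the half-open sector
   [u_i, u_(next i)), where u_i = G a_i. Comparing angles with a fixed direction,
   the indicator of [u_i, u_(next i)) at v is, up to a constant, the difference of
   [u_i <= v] and [u_(next i) <= v]; summed over i this telescopes, so the number K
   of preimages of v <> 0 does not depend on v. A cone contains
   at most two of the preimages of v and - v, at most one if its angle is at most pi,
   and none for a suitable v if its angle is less than pi. As the cones partition the
   plane, at most one of three or more cones has an angle >= pi, so the restrictions
   on n give 2 K < 4, hence K = 1. *)

Require Import Defs.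
From mathcomp Require Import all_boot all_order all_algebra.
From mathcomp Require Import all_classical all_reals all_analysis.
From mathcomp Require Import ring lra zify.
Import Order.TTheory GRing.Theory Num.Theory.
Import numFieldNormedType.Exports.
Local Open Scope classical_set_scope.
Local Open Scope ring_scope.
Set Implicit Arguments.
Unset Strict Implicit.
Unset Printing Implicit Defensive.

(** * Coordinates and determinants in dimension two *)

Lemma colvec2P (R : nmodType) (x y : 'cV[R]_2) :
  x 0 0 = y 0 0 -> x 1 0 = y 1 0 -> x = y.
Proof.
move=> h0 h1; apply/matrixP => i j; rewrite ord1.
case: i => -[|[|//]] p;
  by [rewrite (_ : Ordinal p = 0) //; exact: val_inj
     |rewrite (_ : Ordinal p = 1) //; exact: val_inj].
Qed.

Lemma mulmx2E (R : pzSemiRingType) (A : 'M[R]_2) (x : 'cV[R]_2) i :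
  (A *m x) i 0 = A i 0 * x 0 0 + A i 1 * x 1 0.
Proof.
by rewrite !mxE big_ord_recl big_ord1; congr (_ + A _ _ * x _ _); apply: val_inj.
Qed.

Lemma det_mx22 (R : comNzRingType) (A : 'M[R]_2) :
  \det A = A 0 0 * A 1 1 - A 0 1 * A 1 0.
Proof.
rewrite (expand_det_row _ 0) big_ord_recl big_ord1 /cofactor !det_mx11 !mxE /=.
rewrite expr0 expr1 mul1r mulN1r mulrN.
by congr (A _ _ * A _ _ - A _ _ * A _ _); apply: val_inj.
Qed.

(** * Orientation, the angular order and polar coordinates *)

Section Plane.
Variable R : realType.
Implicit Types (a b e x y : 'cV[R]_2) (A : 'M[R]_2) (t u rho theta phi psi : R).

Definition cross x y : R := x 0 0 * y 1 0 - x 1 0 * y 0 0.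
Definition dot x y : R := x 0 0 * y 0 0 + x 1 0 * y 1 0.

(* The counterclockwise angle in [0, 2 pi) from [a] to [x] is less than pi. *)
Definition upper a x : bool :=
  (0 < cross a x) || (cross a x == 0) && (0 < dot a x).

(* The counterclockwise angle in [0, 2 pi) from [a] to [x] is less than the one
   from [a] to [y]; stated algebraically, so that the invariance under linear
   maps of positive determinant is immediate. *)
Definition ccw_lt a x y : bool :=
  if upper a x then ~~ upper a y || (0 < cross x y)
  else ~~ upper a y && (0 < cross x y).

Lemma cV2_eq0 x : (x == 0) = (x 0 0 == 0) && (x 1 0 == 0).
Proof.
apply/eqP/andP => [-> | [/eqP h0 /eqP h1]]; first by rewrite !mxE.
by apply: colvec2P; rewrite mxE.
Qed.

Lemma dot_gt0 x : x != 0 -> 0 < dot x x.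
Proof.
rewrite cV2_eq0 negb_and /dot -!expr2 => /orP[] h.
- by rewrite ltr_wpDr ?sqr_ge0 // exprn_even_gt0.
- by rewrite ltr_wpDl ?sqr_ge0 // exprn_even_gt0.
Qed.

Lemma cross_mulmx A x y : cross (A *m x) (A *m y) = \det A * cross x y.
Proof. by rewrite det_mx22 /cross !mulmx2E; ring. Qed.

Lemma mulmx_neq0 A x : \det A != 0 -> x != 0 -> A *m x != 0.
Proof.
move=> dA; apply: contra_neq => Ax0.
have uA : A \in unitmx by rewrite unitmxE unitfE.
by rewrite -[x](mulKmx uA) Ax0 mulmx0.
Qed.

(** The cross product scales by the positive determinant; where it vanishes, [x] is a multiple of
    [a], and [A] keeps the coefficient. *)
Lemma upper_mulmx A a x : a != 0 -> 0 < \det A ->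
  upper (A *m a) (A *m x) = upper a x.
Proof.
move=> a0 dA; rewrite /upper cross_mulmx pmulr_rgt0 // mulf_eq0 gt_eqF //=.
congr (_ || _); case: eqP => //= ax0.
have aa := dot_gt0 a0.
have AaAa : 0 < dot (A *m a) (A *m a) by rewrite dot_gt0 // mulmx_neq0 // gt_eqF.
have {ax0} xE : x = (dot a x / dot a a) *: a.
  have {}ax0 : a 0 0 * x 1 0 = a 1 0 * x 0 0 by apply/subr0_eq.
  apply: colvec2P; rewrite !mxE; apply/(mulIf (lt0r_neq0 aa)).
  + by rewrite mulrAC divfK ?gt_eqF // /dot; ring: ax0.
  + by rewrite mulrAC divfK ?gt_eqF // /dot; ring: ax0.
rewrite [in LHS]xE -scalemxAr.
set t := _ / _.
have -> : dot (A *m a) (t *: (A *m a)) = t * dot (A *m a) (A *m a).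
  by rewrite /dot !mxE; ring.
by rewrite pmulr_lgt0 // /t pmulr_lgt0 ?invr_gt0.
Qed.

Lemma ccw_lt_mulmx A a x y : a != 0 -> 0 < \det A ->
  ccw_lt (A *m a) (A *m x) (A *m y) = ccw_lt a x y.
Proof. by move=> a0 dA; rewrite /ccw_lt !upper_mulmx // cross_mulmx pmulr_rgt0. Qed.

Lemma ccw_lt_irr a x : ccw_lt a x x = false.
Proof. by rewrite /ccw_lt /cross mulrC subrr ltxx orbF andbF; case: upper. Qed.

Lemma polar0E rho theta : polar rho theta 0 0 = rho * cos theta.
Proof. by rewrite mxE eqxx. Qed.

Lemma polar1E rho theta : polar rho theta 1 0 = rho * sin theta.
Proof. by rewrite mxE. Qed.

Lemma cross_polar rho theta t u :
  cross (polar rho theta) (polar t u) = rho * t * sin (u - theta).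
Proof. by rewrite /cross !polar0E !polar1E sinB; ring. Qed.

Lemma dot_polar rho theta t u :
  dot (polar rho theta) (polar t u) = rho * t * cos (u - theta).
Proof. by rewrite /dot !polar0E !polar1E cosB; ring. Qed.

Lemma polar_neq0 rho theta : 0 < rho -> polar rho theta != 0.
Proof.
move=> r0; apply/eqP => /(congr1 (fun v => dot v v)).
rewrite dot_polar subrr cos0 /dot !mxE; nra.
Qed.

Lemma polar_rho0 theta : polar (0 : R) theta = 0.
Proof. by apply: colvec2P; rewrite ?polar0E ?polar1E !mxE mul0r. Qed.

Lemma polarDpi rho theta : polar rho (theta + pi) = - polar rho theta.
Proof.
by apply: colvec2P; rewrite ?polar0E ?polar1E [RHS]mxE ?polar0E ?polar1E
  ?cosDpi ?sinDpi mulrN.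
Qed.

Lemma polarD2pi rho theta : polar rho (theta + 2 * pi) = polar rho theta.
Proof. by rewrite mulr_natl mulr2n addrA !polarDpi opprK. Qed.

Lemma sin_le0_pi2pi t : pi <= t <= 2 * pi -> sin t <= 0.
Proof.
move=> ht; have -> : t = (t - pi) + pi by ring.
rewrite sinDpi oppr_le0 sin_ge0_pi //; lra.
Qed.

Lemma sin_le0_Npi0 t : - pi <= t <= 0 -> sin t <= 0.
Proof. by move=> ht; rewrite -[t]opprK sinN oppr_le0 sin_ge0_pi //; lra. Qed.

Lemma upper_polar rho t phi psi : 0 < rho -> 0 < t -> 0 <= psi < 2 * pi ->
  upper (polar rho phi) (polar t (phi + psi)) = (psi < pi).
Proof.
move=> r0 t0 hpsi; have rt : 0 < rho * t by rewrite mulr_gt0.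
rewrite /upper cross_polar dot_polar addrAC subrr add0r !pmulr_rgt0 //.
rewrite mulf_eq0 gt_eqF //=; have pi0 := pi_gt0 R.
have [->|psi0] := eqVneq psi 0; first by rewrite sin0 cos0 eqxx ltr01 orbT pi0.
have [hlt|hgt|->] := ltgtP psi pi; last 1 first.
- by rewrite sinpi cospi !ltxx eqxx /= oppr_gt0 ltr10.
- by rewrite sin_gt0_pi // hlt andbT lt_neqAle eq_sym psi0; case/andP: hpsi.
- have : 0 < sin (psi - pi) by rewrite sin_gt0_pi //; lra.
  have -> : sin psi = - sin (psi - pi) by rewrite -[psi in LHS](subrK pi) sinDpi.
  by move=> s0; rewrite ltNge oppr_le0 (ltW s0) oppr_eq0 gt_eqF.
Qed.

(** This identifies the algebraic order with the order of angles counted from the ray at [phi]. *)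
Lemma ccw_lt_polar rho t u phi psi chi :
  0 < rho -> 0 < t -> 0 < u -> 0 <= psi < 2 * pi -> 0 <= chi < 2 * pi ->
  ccw_lt (polar rho phi) (polar t (phi + psi)) (polar u (phi + chi)) = (psi < chi).
Proof.
move=> r0 t0 u0 hpsi hchi; rewrite /ccw_lt !upper_polar //.
rewrite cross_polar pmulr_rgt0 ?mulr_gt0 //.
have -> : phi + chi - (phi + psi) = chi - psi by ring.
(* Angles on the same side of [pi] differ by less than [pi], so the sine of the difference has its
   sign. *)
have same : `|chi - psi| < pi -> (0 < sin (chi - psi)) = (psi < chi).
  rewrite ltr_norml => hd; have [h|h] := ltP psi chi.
    by rewrite sin_gt0_pi //; lra.
  by apply/negbTE; rewrite -leNgt sin_le0_Npi0 //; lra.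
have [h1|h1] := ltP psi pi; have [h2|h2] := ltP chi pi => /=.
- by rewrite same // ltr_norml; lra.
- by apply/esym; lra.
- by apply/esym/negbTE; rewrite -leNgt; lra.
- by rewrite same // ltr_norml; lra.
Qed.

Definition rotation theta x : 'cV[R]_2 :=
  \col_i (if i == 0 then cos theta * x 0 0 - sin theta * x 1 0
          else sin theta * x 0 0 + cos theta * x 1 0).

Lemma rotation0E theta x : rotation theta x 0 0 = cos theta * x 0 0 - sin theta * x 1 0.
Proof. by rewrite mxE. Qed.

Lemma rotation1E theta x : rotation theta x 1 0 = sin theta * x 0 0 + cos theta * x 1 0.
Proof. by rewrite mxE. Qed.

Lemma rotation_polar t rho theta : rotation t (polar rho theta) = polar rho (theta + t).
Proof.
by apply: colvec2P; rewrite ?rotation0E ?rotation1E ?polar0E ?polar1E ?cosD ?sinD; ring.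
Qed.

Lemma rotationK t : cancel (rotation (- t)) (rotation t).
Proof.
move=> x; have h := cos2sin2 t.
by apply: colvec2P; rewrite !(rotation0E, rotation1E) cosN sinN; ring: h.
Qed.

Lemma polar_ex x phi : x != 0 ->
  exists rho psi, [/\ 0 < rho, 0 <= psi < 2 * pi & x = polar rho (phi + psi)].
Proof.
(* Rotating by [- phi] reduces to angles counted from the first axis; there [acos] gives the angle
   up to sign, and the second coordinate decides the sign. *)
move=> x0; pose y := rotation (- phi) x.
have xE : x = rotation phi y by rewrite rotationK.
have y0 : y != 0.
  apply: contra_neq x0; rewrite xE => ->.
  by apply: colvec2P; rewrite ?rotation0E ?rotation1E !mxE !mulr0 ?subr0 ?addr0.
suff [rho [psi [r0 hpsi yE]]] :
    exists rho psi, [/\ 0 < rho, 0 <= psi < 2 * pi & y = polar rho psi].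
  by exists rho, psi; split => //; rewrite xE yE rotation_polar addrC.
have yy := dot_gt0 y0; set rho := Num.sqrt (dot y y).
have r0 : 0 < rho by rewrite sqrtr_gt0.
have rr : rho ^+ 2 = y 0 0 ^+ 2 + y 1 0 ^+ 2.
  by rewrite sqr_sqrtr ?ltW // /dot !expr2.
pose c := y 0 0 / rho; pose s := y 1 0 / rho.
have c0 : y 0 0 = rho * c by rewrite /c mulrC divfK // gt_eqF.
have s0 : y 1 0 = rho * s by rewrite /s mulrC divfK // gt_eqF.
have cs : c ^+ 2 + s ^+ 2 = 1.
  by rewrite /c /s !expr_div_n -mulrDl -rr divff // expf_neq0 // gt_eqF.
have c1 : -1 <= c <= 1 by nra.
have pi0 := pi_gt0 R; have a0 := acos_ge0 c1; have a1 := acos_lepi c1.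
have sacos : sin (acos c) = `|s|.
  by rewrite sin_acos // -cs addrAC subrr add0r sqrtr_sqr.
have cacos : cos (acos c) = c by rewrite acosK.
have [sge|slt] := leP 0 s.
  exists rho, (acos c); split => //; first by lra.
  by apply: colvec2P; rewrite ?polar0E ?polar1E ?cacos ?sacos ?ger0_norm.
exists rho, (2 * pi - acos c); split => //.
  have c1' : -1 <= c < 1 by nra.
  have := acos_gt0 c1'; lra.
have p2 : polar rho (2 * pi - acos c) = polar rho (- acos c).
  by rewrite addrC polarD2pi.
by rewrite p2; apply: colvec2P;
  rewrite ?polar0E ?polar1E ?sinN ?cosN ?cacos ?sacos ?ltr0_norm ?opprK.
Qed.

(* Telescoping: with [e] as origin of the angles, membership of [x] in the arc
   [[a, b)] is the difference of two indicators, up to a term free of [x]. *)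
Lemma ccw_lt_telescope e a b x :
  e != 0 -> a != 0 -> b != 0 -> x != 0 -> ccw_lt a a b ->
  (ccw_lt a x b + ~~ ccw_lt e x b = ~~ ccw_lt e x a + ccw_lt e b a)%N.
Proof.
move=> e0 a0 b0 x0.
have [r [t0 [r0 _ ->]]] := polar_ex 0 e0; rewrite add0r.
have [ra [ta [ra0 hta ->]]] := polar_ex t0 a0.
have [rb [tb [rb0 htb ->]]] := polar_ex t0 b0.
have [rx [tx [rx0 htx ->]]] := polar_ex t0 x0.
rewrite !ccw_lt_polar //.
have shift r' t' : polar r' (t0 + t') = polar r' (t0 + ta + (t' - ta)).
  by congr polar; ring.
have shift2 r' t' : polar r' (t0 + t') = polar r' (t0 + ta + (t' - ta + 2 * pi)).
  by rewrite addrA polarD2pi shift.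
(* [red t'] is the angle counted from [a] instead of [e], reduced to [0, 2 pi). *)
pose red t' := if t' < ta then t' - ta + 2 * pi else t' - ta.
have redE r' t' : polar r' (t0 + t') = polar r' (t0 + ta + red t').
  by rewrite /red; case: ifP => _; [exact: shift2 | exact: shift].
have redP t' : 0 <= t' < 2 * pi -> 0 <= red t' < 2 * pi.
  by rewrite /red; case: (ltP t' ta) => *; lra.
have ha : polar ra (t0 + ta) = polar ra (t0 + ta + 0) by rewrite addr0.
have -> : ccw_lt (polar ra (t0 + ta)) (polar ra (t0 + ta)) (polar rb (t0 + tb))
   = (0 < red tb).
  rewrite (redE rb) [X in ccw_lt _ X _]ha ccw_lt_polar //; last exact: redP.
  by have := pi_gt0 R; lra.
have -> : ccw_lt (polar ra (t0 + ta)) (polar rx (t0 + tx)) (polar rb (t0 + tb))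
   = (red tx < red tb).
  by rewrite (redE rb) (redE rx) ccw_lt_polar //; exact: redP.
move=> hab; have pi0 := pi_gt0 R.
case: (ltP (red tx) (red tb)) hab; rewrite /red;
  case: (ltP tb ta) => h1; case: (ltP tx ta) => h2; case: (ltP tx tb) => h3;
  move=> h4 h5; first [done | exfalso; lra].
Qed.

End Plane.

(** * Closed sectors and their half-open versions *)

Section Sectors.
Variable R : realType.
Implicit Types (a b c e x y : 'cV[R]_2) (A : 'M[R]_2) (t u rho theta phi psi : R).

Lemma near_cross_gt0 c x : 0 < cross c x -> \forall y \near x, 0 < cross c y.
Proof.
have cc : cross c y @[y --> x] --> cross c x.
  apply: (@cvgB R R _ (nbhs x) _ (fun y : 'cV[R]_2 => c 0 0 * y 1 0)
    (fun y : 'cV[R]_2 => c 1 0 * y 0 0));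
    by apply: (@cvgMl_tmp R); exact: coord_continuous.
by move=> h; exact: (cvgr_gt _ cc).
Qed.

(** Local continuity of the angle: as [d <= pi / 2], two open half-planes cut out the open sector of
    half-width [d] around [phi]. *)
Lemma near_polar rho phi l r : 0 < rho -> l < phi < r ->
  \forall y \near polar rho phi,
    exists t u, [/\ 0 < t, l < u < r & y = polar t u].
Proof.
move=> r0 hphi; have pi0 := pi_gt0 R.
pose d := Num.min (Num.min (phi - l) (r - phi)) (pi / 2).
have d0 : 0 < d by rewrite !lt_min; apply/andP; split; [apply/andP; split|]; lra.
have dl : d <= phi - l by rewrite !ge_min lexx.
have dr : d <= r - phi by rewrite !ge_min lexx orbT.
have dp : d <= pi / 2 by rewrite !ge_min lexx orbT.
have h1 : 0 < cross (polar 1 (phi - d)) (polar rho phi).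
  rewrite cross_polar mul1r mulr_gt0 // subKr sin_gt0_pi //; lra.
have h2 : 0 < cross (polar 1 (phi + d - pi)) (polar rho phi).
  rewrite cross_polar mul1r mulr_gt0 // sin_gt0_pi //; lra.
apply: filterS2 (near_cross_gt0 h1) (near_cross_gt0 h2) => y y1 y2.
have y0 : y != 0.
  by apply: contraTneq y1 => ->; rewrite /cross !mxE !mulr0 subr0 ltxx.
have [t [psi [t0 hpsi yE]]] := polar_ex (phi - d) y0.
exists t, (phi - d + psi); split => //.
move: y1 y2; rewrite yE !cross_polar !mul1r !pmulr_rgt0 //.
rewrite addrAC subrr add0r => s1 s2.
have psipi : psi < pi.
  by rewrite ltNge; apply/negP => h; have := @sin_le0_pi2pi R psi; lra.
have hd : phi - d + psi - (phi + d - pi) < pi.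
  rewrite ltNge; apply/negP => h.
  have : sin (phi - d + psi - (phi + d - pi)) <= 0 by rewrite sin_le0_pi2pi //; lra.
  by rewrite leNgt s2.
have psi0 : 0 < psi.
  rewrite lt_neqAle eq_sym; apply/andP; split; last by lra.
  by apply: contraTneq s1 => ->; rewrite sin0 ltxx.
lra.
Qed.

Section OneSector.
Variables alpha beta : R.
Hypothesis hab : 0 < beta - alpha < 2 * pi.

Lemma sector0 : sector alpha beta 0.
Proof.
by exists 0, alpha; rewrite polar_rho0; split => //; move: hab; lra.
Qed.

(** Counted from [alpha], both angles lie in [0, 2 pi), so equal points would satisfy the strict
    order, which is irreflexive. *)
Lemma polar_notin_sector rho theta : 0 < rho -> beta < theta < alpha + 2 * pi ->
  ~ sector alpha beta (polar rho theta).
Proof.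
move=> r0 ht [t [u [t0 hu E]]].
have {}t0 : 0 < t.
  rewrite lt_neqAle t0 andbT; apply/eqP => tE; move: E.
  by rewrite -tE polar_rho0; apply/eqP; exact: polar_neq0.
have h1 : 0 <= theta - alpha < 2 * pi by move: hab; lra.
have h2 : 0 <= u - alpha < 2 * pi by move: hab; lra.
have := @ccw_lt_polar R 1 t rho alpha (u - alpha) (theta - alpha) ltr01 t0 r0 h2 h1.
rewrite ![alpha + _]addrC !subrK E ccw_lt_irr => /esym.
lra.
Qed.

Lemma polar_interior_sector rho theta : 0 < rho -> alpha < theta < beta ->
  (sector alpha beta)° (polar rho theta).
Proof.
move=> r0 /(near_polar r0); apply: filterS => y [t [u [t0 hu ->]]].
by exists t, u; split => //; lra.
Qed.

Lemma sector_closed : closed (sector alpha beta).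
Proof.
rewrite -openC openE => x xS; have x0 : x != 0.
  by apply: contra_notN xS => /eqP ->; exact: sector0.
have [t [psi [t0 hpsi xE]]] := polar_ex alpha x0.
have hb : beta < alpha + psi.
  by rewrite ltNge; apply/negP => h; apply: xS; exists t, (alpha + psi); split => //; lra.
have hr : beta < alpha + psi < alpha + 2 * pi by lra.
rewrite /interior /= xE; have := near_polar t0 hr.
by apply: filterS => y [s [u [s0 hu ->]]]; exact: polar_notin_sector.
Qed.

(** The final ray is left out so that the sectors of a decomposition do not overlap; [ccw_lt] lets
    linear maps transport the predicate. *)
Definition in_arc x : bool := ccw_lt (polar 1 alpha) x (polar 1 beta).

Lemma arc_polar rho psi : 0 < rho -> 0 <= psi < 2 * pi ->
  in_arc (polar rho (alpha + psi)) = (psi < beta - alpha).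
Proof.
move=> r0 hpsi; rewrite -(@ccw_lt_polar R 1 rho 1 alpha) //; last by move: hab; lra.
by rewrite [alpha + (beta - _)]addrC subrK.
Qed.

Lemma arc_start : in_arc (polar 1 alpha).
Proof. by rewrite -[alpha]addr0 arc_polar //; have := pi_gt0 R; move: hab; lra. Qed.

Lemma arc_end : in_arc (polar 1 beta) = false.
Proof. exact: ccw_lt_irr. Qed.

Lemma arc_sector x : x != 0 -> in_arc x -> sector alpha beta x.
Proof.
move=> x0; have [t [psi [t0 hpsi ->]]] := polar_ex alpha x0.
rewrite arc_polar // => h; exists t, (alpha + psi); split => //; lra.
Qed.

(** The opposite ray has angle [psi + pi] or [psi - pi], whichever lies in [0, 2 pi). *)
Lemma arcN_polar rho psi : 0 < rho -> 0 <= psi < 2 * pi ->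
  in_arc (- polar rho (alpha + psi)) =
  if psi < pi then psi + pi < beta - alpha else psi - pi < beta - alpha.
Proof.
move=> r0 hpsi; rewrite -polarDpi; case: ltP => h.
  by rewrite -addrA arc_polar //; lra.
rewrite -(arc_polar (rho := rho)) //; last by lra.
by rewrite -[in RHS]polarD2pi; congr (in_arc (polar _ _)); ring.
Qed.

Lemma arc_pair_le1 x : x != 0 -> beta - alpha <= pi -> (in_arc x + in_arc (- x) <= 1)%N.
Proof.
move=> x0 h; have [t [psi [t0 hpsi ->]]] := polar_ex alpha x0.
rewrite arcN_polar // arc_polar //.
case: (ltP psi pi) => h1; case: ltP => h2; case: ltP => h3 //; exfalso; lra.
Qed.

Lemma arc_pair_ge1 x : x != 0 -> pi <= beta - alpha -> (1 <= in_arc x + in_arc (- x))%N.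
Proof.
move=> x0 h; have [t [psi [t0 hpsi ->]]] := polar_ex alpha x0.
rewrite arcN_polar // arc_polar //.
case: (ltP psi pi) => h1; case: ltP => h2; case: ltP => h3 //; exfalso; lra.
Qed.

(** Together with [arc_end], this gives a vector such that neither it nor its opposite lies in the
    half-open sector. *)
Lemma arcN_end : beta - alpha < pi -> in_arc (- polar 1 beta) = false.
Proof.
move=> h; rewrite (_ : beta = alpha + (beta - alpha)); last by ring.
by rewrite arcN_polar // ?h; have := pi_gt0 R; move: h hab; lra.
Qed.

Lemma arcN_start : pi < beta - alpha -> in_arc (- polar 1 alpha).
Proof.
move=> h; rewrite -[alpha]addr0 arcN_polar //; last by have := pi_gt0 R; lra.
by rewrite pi_gt0 add0r.
Qed.

(* [x] lies in a half-open sector iff its small counterclockwise rotations lie in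
   the closed one; hence the half-open sectors of a decomposition form a partition. *)
Lemma arc_rot_interior x : x != 0 -> in_arc x ->
  \forall e \near 0^'+, (sector alpha beta)° (rotation e x).
Proof.
move=> x0; have [t [psi [t0 hpsi ->]]] := polar_ex alpha x0.
rewrite arc_polar // => h.
have h' : 0 < beta - alpha - psi by lra.
near=> e; rewrite rotation_polar; apply: polar_interior_sector => //.
have e1 : 0 < e by near: e; exact: nbhs_right_gt.
have e2 : e < beta - alpha - psi by near: e; exact: nbhs_right_lt.
lra.
Unshelve. all: by end_near.
Qed.

Lemma notin_arc_rot x : x != 0 -> ~~ in_arc x ->
  \forall e \near 0^'+, ~ sector alpha beta (rotation e x).
Proof.
move=> x0; have [t [psi [t0 hpsi ->]]] := polar_ex alpha x0.
rewrite arc_polar // -leNgt => h.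
have h' : 0 < 2 * pi - psi by lra.
near=> e; rewrite rotation_polar; apply: polar_notin_sector => //.
have e1 : 0 < e by near: e; exact: nbhs_right_gt.
have e2 : e < 2 * pi - psi by near: e; exact: nbhs_right_lt.
lra.
Unshelve. all: by end_near.
Qed.

Lemma end_rotN_interior :
  \forall e \near 0^'+, (sector alpha beta)° (rotation (- e) (polar 1 beta)).
Proof.
have h' : 0 < beta - alpha by move: hab; lra.
near=> e; rewrite rotation_polar; apply: polar_interior_sector => //.
have e1 : 0 < e by near: e; exact: nbhs_right_gt.
have e2 : e < beta - alpha by near: e; exact: nbhs_right_lt.
lra.
Unshelve. all: by end_near.
Qed.

(** Clockwise counterpart, in which the initial ray is exceptional; it serves to recognise a final
    ray as an initial one. *)
Lemma arc_rotN_interior x : x != 0 -> in_arc x ->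
  (exists2 t, 0 < t & x = polar t alpha) \/
  \forall e \near 0^'+, (sector alpha beta)° (rotation (- e) x).
Proof.
move=> x0; have [t [psi [t0 hpsi ->]]] := polar_ex alpha x0.
rewrite arc_polar // => h.
have [->|psi0] := eqVneq psi 0; first by left; exists t; rewrite ?addr0.
have {}psi0 : 0 < psi by rewrite lt_neqAle eq_sym psi0; lra.
right; near=> e; rewrite rotation_polar; apply: polar_interior_sector => //.
have e1 : 0 < e by near: e; exact: nbhs_right_gt.
have e2 : e < psi by near: e; exact: nbhs_right_lt.
lra.
Unshelve. all: by end_near.
Qed.

Lemma convex_sector_le_pi : convex_set (sector alpha beta) -> beta - alpha <= pi.
Proof.
move=> cvx; rewrite leNgt; apply/negP => hpi; have pi0 := pi_gt0 R.
(* The midpoint of the two ends lies on the bisector of the complement. *)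
pose m := (beta + (alpha + 2 * pi)) / 2; pose d := (alpha + 2 * pi - beta) / 2.
have cd : 0 < cos d by rewrite cos_gt0_pihalf // /d; move: hab; lra.
have hm : beta < m < alpha + 2 * pi by rewrite /m; move: hab; lra.
apply: (@polar_notin_sector (cos d) m cd hm).
have h1 : sector alpha beta (polar 1 beta).
  by exists 1, beta; split => //; move: hab; lra.
have h2 : sector alpha beta (polar 1 alpha).
  by exists 1, alpha; split => //; move: hab; lra.
have k0 : 0 <= 2^-1 :> R by lra.
have k1 : 2^-1 <= 1 :> R by lra.
have := cvx _ _ (Itv01 k0 k1) (mem_set h1) (mem_set h2).
move=> /set_mem; congr (sector _ _ _).
(* The two ends are the unit vectors at the angles [m + d] and [m - d], with midpoint
   [polar (cos d) m]. *)
rewrite -(polarD2pi 1 alpha) (_ : alpha + 2 * pi = m + d); last by rewrite /m /d; field.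
rewrite [in polar 1 beta](_ : beta = m - d); last by rewrite /m /d; field.
by apply: colvec2P; rewrite ![LHS]mxE [X in X + _]mxE [X in _ + X]mxE
  !(polar0E, polar1E) ?cosB ?cosD ?sinB ?sinD /unstable.onem /=; field.
Qed.

End OneSector.
End Sectors.

(** * Counting by indicators, and continuity of linear maps *)

Lemma sum_nat_eq1 (I : finType) (k : I) : (\sum_i (i == k) = 1)%N.
Proof. by rewrite -(@big_mkcond _ _ _ _ _ (fun i => i == k)) sum1_card card1. Qed.

Lemma sum_bool_eq1_uniq (I : finType) (F : I -> bool) i j :
  (\sum_k F k = 1)%N -> F i -> F j -> i = j.
Proof.
move=> FE Fi Fj; apply/eqP/negPn/negP => ij; move: FE.
by rewrite (bigD1 i) //= (bigD1 j) 1?eq_sym //= Fi Fj.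
Qed.

Lemma mulmx_continuous (R : realType) (A : 'M[R]_2) :
  continuous (fun x : 'cV[R]_2 => A *m x).
Proof.
move=> /= x P /nbhs_ballP[e /= e0 eP].
have cc i : (A *m y) i 0 @[y --> x] --> (A *m x) i 0.
  rewrite mulmx2E; under eq_fun do rewrite mulmx2E.
  apply: (@cvgD R R _ (nbhs x) _ (fun y : 'cV[R]_2 => A i 0 * y 0 0)
    (fun y : 'cV[R]_2 => A i 1 * y 1 0));
    by apply: (@cvgMl_tmp R); exact: coord_continuous.
have near_i : \forall y \near x, forall i, ball ((A *m x) i 0) e ((A *m y) i 0).
  by apply: (@filter_forall _ 'I_2 _ (nbhs x)) => i; exact: (cvg_ball (cc i)).
by apply: filterS near_i => y hy; apply: eP; split=> // i j; rewrite ord1.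
Qed.

(** * Combinatorics of a decomposition into sectors *)

Section Decomposition.
Variables (R : realType) (n : nat) (alpha beta : 'I_n -> R).
Hypothesis width : forall i, 0 < beta i - alpha i < 2 * pi.
Hypothesis cover : forall x : 'cV[R]_2, exists i, sector (alpha i) (beta i) x.
Hypothesis disj : forall i j, i != j ->
  (sector (alpha i) (beta i))° `&` (sector (alpha j) (beta j))° = set0.
Implicit Types (x v w : 'cV[R]_2).

Let H i := in_arc (alpha i) (beta i).
Let a i : 'cV[R]_2 := polar 1 (alpha i).
Let b i : 'cV[R]_2 := polar 1 (beta i).
Let s i := beta i - alpha i.

Let a_neq0 i : a i != 0. Proof. exact: polar_neq0. Qed.
Let b_neq0 i : b i != 0. Proof. exact: polar_neq0. Qed.

Lemma interior_near_eq (f : R -> 'cV[R]_2) i j :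
  (\forall e \near 0^'+, (sector (alpha i) (beta i))° (f e)) ->
  (\forall e \near 0^'+, (sector (alpha j) (beta j))° (f e)) -> i = j.
Proof.
move=> hi hj; apply/eqP/negPn/negP => /disj ij0.
have : \forall e \near (0 : R)^'+, False.
  by apply: filterS2 hi hj => e ei ej; suff : set0 (f e) by []; rewrite -ij0.
by case/filter_ex.
Qed.

(** Otherwise a single small rotation of [x] would escape all of the finitely many closed
    sectors. *)
Lemma arc_ex x : x != 0 -> exists i, H i x.
Proof.
move=> x0; apply: contrapT => /forallNP hx.
have : \forall e \near (0 : R)^'+, forall i, ~ sector (alpha i) (beta i) (rotation e x).
  by apply: filter_forall => i; apply: notin_arc_rot => //; exact/negP/hx.
by move=> /(@filter_ex _ (0^'+) _) [e he]; have [i /he] := cover (rotation e x).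
Qed.

Lemma arc_uniq x i j : x != 0 -> H i x -> H j x -> i = j.
Proof.
move=> x0 hi hj; apply: (@interior_near_eq (fun e => rotation e x));
  by [exact: arc_rot_interior hi | exact: arc_rot_interior hj].
Qed.

Lemma arc_sum x : x != 0 -> (\sum_i H i x = 1)%N.
Proof.
move=> x0; have [i hi] := arc_ex x0.
rewrite -(sum_nat_eq1 i); apply: eq_bigr => j _; congr nat_of_bool.
by apply/idP/eqP => [hj | ->//]; exact: arc_uniq hj hi.
Qed.

(** If the final ray of [i] lies in the half-open sector [j], it is the initial ray of [j]:
    otherwise its small clockwise rotations are interior to both, so [i = j], but no half-open
    sector contains its own final ray. Two sectors with the same final ray share interior points,
    whence injectivity. *)
Lemma next_arc : exists2 next : 'I_n -> 'I_n,
  injective next & forall i, b i = a (next i).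
Proof.
have hb i : exists j, b i = a j.
  have [j hj] := arc_ex (b_neq0 i); exists j.
  have [[t t0 bE]|hint] := arc_rotN_interior (width j) (b_neq0 i) hj.
    (* Comparing squared lengths gives [t ^+ 2 = 1], hence [t = 1]. *)
    have : dot (b i) (b i) = dot (polar t (alpha j)) (polar t (alpha j)) by rewrite -bE.
    rewrite !dot_polar !subrr cos0 bE => /eqP; rewrite !mulr1 => /eqP t2.
    by rewrite /a (_ : t = 1) //; nra.
  have ij : i = j := interior_near_eq (end_rotN_interior (width i)) hint.
  by move: hj; rewrite -ij /H arc_end.
have [next nextE] := choice hb; exists next => // i j ij.
have bij : b i = b j by rewrite !nextE ij.
apply: (interior_near_eq (end_rotN_interior (width i))).
by rewrite -/(b i) bij; exact: end_rotN_interior.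
Qed.

Let pair i x := (H i x + H i (- x))%N.

Let pair_sum x : x != 0 -> (\sum_i pair i x = 2)%N.
Proof. by move=> x0; rewrite big_split /= !arc_sum // oppr_eq0. Qed.

(** Sectors [i] and [j] each contain [a k] or [- a k], and sector [k] contains [a k]: three
    incidences where the total is two. *)
Lemma half_planes_fill i j k :
  i != j -> i != k -> j != k -> pi <= s i -> pi <= s j -> False.
Proof.
move=> ij ik jk si sj; have := pair_sum (a_neq0 k).
rewrite (bigD1 i) //= (bigD1 j) 1?eq_sym //= (bigD1 k); last first.
  by rewrite /= ![k == _]eq_sym ik jk.
have := arc_pair_ge1 (width i) (a_neq0 k) si.
have := arc_pair_ge1 (width j) (a_neq0 k) sj.
have : (1 <= pair k (a k))%N by rewrite /pair /H arc_start.
rewrite -/(H i) -/(H j) /pair /=; lia.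
Qed.

(** Sector [i] contains both [a i] and [- a i], and sector [j] at least one of them: again three
    incidences. *)
Lemma reflex_width_uniq i j : i != j -> pi < s i -> pi < s j -> False.
Proof.
move=> ij si sj; have := pair_sum (a_neq0 i).
rewrite (bigD1 i) //= (bigD1 j) 1?eq_sym //=.
have := arc_pair_ge1 (width j) (a_neq0 i) (ltW sj).
rewrite {1}/pair /H arc_start // (arcN_start (width i)) // /pair /H; lia.
Qed.

(** * Counting preimages *)

Section Images.
Variable L : 'I_n -> 'M[R]_2.
Hypothesis L_inj : forall i, \det (L i) != 0.

Definition preimages v := (\sum_i H i (invmx (L i) *m v))%N.

Let Lunit i : L i \in unitmx. Proof. by rewrite unitmxE unitfE. Qed.

Let inv_neq0 i v : v != 0 -> invmx (L i) *m v != 0.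
Proof. by move=> v0; rewrite mulmx_neq0 // det_inv invr_neq0. Qed.

Let preimages_pair v :
  (preimages v + preimages (- v) = \sum_i pair i (invmx (L i) *m v))%N.
Proof. by rewrite -big_split; apply: eq_bigr => i _; rewrite /= mulmxN. Qed.

Let pair_le2 i x : (pair i x <= 2)%N.
Proof. by rewrite /pair; do 2!case: (H i _). Qed.

Let pair_le1 i x : x != 0 -> s i <= pi -> (pair i x <= 1)%N.
Proof. exact: arc_pair_le1. Qed.

Let pair_end k : s k < pi -> pair k (invmx (L k) *m (L k *m b k)) = 0%N.
Proof. by move=> sk; rewrite mulKmx // /pair /H arc_end arcN_end. Qed.

(** A sector contributes at most 2 to the sum of pairs, at most 1 if its width is at most [pi], and
    0 if its width is less than [pi] and [v] is the image of its final ray. Each case finds enough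
    narrow sectors to stay below 4. *)
Lemma preimages_pair_small :
  [\/ n = 1%N, n = 2%N | n = 3%N] \/ (n = 4%N /\ forall i, s i <= pi) ->
  exists2 v, v != 0 & (preimages v + preimages (- v) < 4)%N.
Proof.
have Lb0 k : L k *m b k != 0 by rewrite mulmx_neq0.
have sumc c : (\sum_(i < n) c = n * c)%N by rewrite sum_nat_const card_ord.
have ord k : (k < n)%N -> {i : 'I_n | i = k :> nat} by move=> h; exists (Ordinal h).
have neq (i j : 'I_n) : i <> j :> nat -> i != j by move=> h; apply/eqP => /(congr1 val).
case=> [[n1|n2|n3]|[n4 cvx]].
- have [|i0 _] := ord 0%N; first by rewrite n1.
  exists (b i0) => //; rewrite preimages_pair.
  have : (\sum_i pair i (invmx (L i) *m b i0) <= \sum_(i < n) 2)%N.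
    by apply: leq_sum => i _; exact: pair_le2.
  rewrite sumc; lia.
- have [|i0 e0] := ord 0%N; first by rewrite n2.
  have [|i1 e1] := ord 1%N; first by rewrite n2.
  (* Two widths above [pi] are excluded, so one sector saves 1 from the bound 4. *)
  have [k sk] : exists k, s k <= pi.
    have [h0|h0] := leP (s i0) pi; first by exists i0.
    have [h1|h1] := leP (s i1) pi; first by exists i1.
    by case: (reflex_width_uniq _ h0 h1); apply: neq; lia.
  exists (b k) => //; rewrite preimages_pair.
  have : (\sum_i (pair i (invmx (L i) *m b k) + (i == k)) <= \sum_(i < n) 2)%N.
    apply: leq_sum => i _; case: eqP => [->|_]; last by rewrite addn0.
    by have := @pair_le1 k (invmx (L k) *m b k) (inv_neq0 k (b_neq0 k)) sk; lia.
  rewrite big_split /= sum_nat_eq1 sumc; lia.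
- have [|i0 e0] := ord 0%N; first by rewrite n3.
  have [|i1 e1] := ord 1%N; first by rewrite n3.
  have [|i2 e2] := ord 2%N; first by rewrite n3.
  (* As there is a third sector, at most one width can reach [pi]. *)
  have [k [l [kl sk sl]]] : exists k l, [/\ k != l, s k < pi & s l < pi].
    have n01 : i0 != i1 by apply: neq; lia.
    have n02 : i0 != i2 by apply: neq; lia.
    have n12 : i1 != i2 by apply: neq; lia.
    have n10 : i1 != i0 by rewrite eq_sym.
    have n20 : i2 != i0 by rewrite eq_sym.
    have n21 : i2 != i1 by rewrite eq_sym.
    have [h0|h0] := ltP (s i0) pi; have [h1|h1] := ltP (s i1) pi.
    + by exists i0, i1.
    + have [h2|h2] := ltP (s i2) pi; first by exists i0, i2.
      by case: (half_planes_fill _ _ _ h1 h2 (k := i0)).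
    + have [h2|h2] := ltP (s i2) pi; first by exists i1, i2.
      by case: (half_planes_fill _ _ _ h0 h2 (k := i1)).
    + by case: (half_planes_fill _ _ _ h0 h1 (k := i2)).
  exists (L k *m b k) => //; rewrite preimages_pair.
  (* The added indicators record the savings: 2 at [k], where the contribution is 0, and 1 at [l];
     the bound becomes 6 - 3. *)
  have : (\sum_i (pair i (invmx (L i) *m (L k *m b k)) + ((i == k) + (i == k) + (i == l)))
          <= \sum_(i < n) 2)%N.
    apply: leq_sum => i _; have [->|_] := eqVneq i k.
      by rewrite pair_end // (negPf kl).
    have [->|_] := eqVneq i l; last by rewrite addn0.
    by have := @pair_le1 l _ (inv_neq0 l (Lb0 k)) (ltW sl); lia.
  rewrite !big_split /= !sum_nat_eq1 sumc; lia.
- have [|i0 e0] := ord 0%N; first by rewrite n4.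
  have [|i1 e1] := ord 1%N; first by rewrite n4.
  have [|i2 e2] := ord 2%N; first by rewrite n4.
  have [k sk] : exists k, s k < pi.
    have [h0|h0] := ltP (s i0) pi; first by exists i0.
    have [h1|h1] := ltP (s i1) pi; first by exists i1.
    by case: (half_planes_fill _ _ _ h0 h1 (k := i2)); apply: neq; lia.
  (* This vector kills the contribution of sector [k]; the other three give at most 1 each. *)
  exists (L k *m b k) => //; rewrite preimages_pair.
  have : (\sum_i (pair i (invmx (L i) *m (L k *m b k)) + (i == k)) <= \sum_(i < n) 1)%N.
    apply: leq_sum => i _; have [->|_] := eqVneq i k; first by rewrite pair_end.
    by rewrite addn0; apply: pair_le1 => //; exact: inv_neq0.
  rewrite big_split /= sum_nat_eq1 sumc; lia.
Qed.

Hypothesis L_agree : forall i j x,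
  sector (alpha i) (beta i) x -> sector (alpha j) (beta j) x -> L i *m x = L j *m x.

(** The image arcs run from [u i] to [u (next i)]; when [ccw_lt_telescope] is summed over [i], the
    terms depending on the point cancel because [next] is a permutation. *)
Lemma preimages_const v w : (forall i, 0 < \det (L i)) ->
  v != 0 -> w != 0 -> preimages v = preimages w.
Proof.
move=> dL v0 w0; have [next next_inj nextE] := next_arc.
pose u i := L i *m a i.
have uE i : L i *m b i = u (next i).
  rewrite /u -nextE; apply: L_agree.
    by exists 1, (beta i); split => //; have := width i; lra.
  rewrite nextE; exists 1, (alpha (next i)); split => //.
  by have := width (next i); lra.
have u0 i : u i != 0 by rewrite mulmx_neq0.
have HE i z : H i (invmx (L i) *m z) = ccw_lt (u i) z (u (next i)).
  rewrite -uE -[in RHS](mulKVmx (Lunit i) z).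
  by rewrite ccw_lt_mulmx //.
suff tele z : z != 0 ->
    (preimages z = \sum_i ccw_lt (polar 1 0) (u (next i)) (u i))%N.
  by rewrite !tele.
move=> z0; pose e : 'cV[R]_2 := polar 1 0.
have e0 : e != 0 by exact: polar_neq0.
(* Telescoping without subtraction: the same sum is added to both sides and reindexed by [next] on
   the left. *)
apply: (@addIn (\sum_i ~~ ccw_lt e z (u i))%N) => /=.
rewrite [in LHS](reindex_inj next_inj) -!big_split /=.
apply: eq_bigr => i _; rewrite HE ccw_lt_telescope //; first by rewrite addnC.
by rewrite -uE ccw_lt_mulmx //; exact: arc_start.
Qed.

(** The constant count is less than 2 by the bound on [w] and [- w], and positive because
    [L i *m a i] has the preimage [a i]. *)
Lemma preimages_eq1_of_det_gt0 v :
  [\/ n = 1%N, n = 2%N | n = 3%N] \/ (n = 4%N /\ forall i, s i <= pi) ->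
  (forall i, 0 < \det (L i)) -> v != 0 -> preimages v = 1%N.
Proof.
move=> Hn dL v0; have [w w0] := preimages_pair_small Hn.
have Nw0 : - w != 0 by rewrite oppr_eq0.
rewrite (preimages_const dL w0 v0) (preimages_const dL Nw0 v0) => lt4.
have [i _] := cover 0.
have La0 : L i *m a i != 0 by rewrite mulmx_neq0.
suff : (0 < preimages v)%N by lia.
rewrite (preimages_const dL v0 La0) /preimages (bigD1 i) //= mulKmx //.
by rewrite /H arc_start.
Qed.

End Images.
(* Composing with a reflection of the target reduces negative determinants to
   positive ones. *)
Lemma preimages_eq1 (L : 'I_n -> 'M[R]_2) v :
  [\/ n = 1%N, n = 2%N | n = 3%N] \/ (n = 4%N /\ forall i, s i <= pi) ->
  (forall i, \det (L i) != 0) ->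
  (forall i j, Num.sg (\det (L i)) = Num.sg (\det (L j))) ->
  (forall i j x, sector (alpha i) (beta i) x -> sector (alpha j) (beta j) x ->
     L i *m x = L j *m x) ->
  v != 0 -> preimages L v = 1%N.
Proof.
move=> Hn L0 Lsg Lagree v0; have [i0 _] := cover 0.
have [Lpos|Lneg] : 0 < \det (L i0) \/ \det (L i0) < 0.
  by have := L0 i0; rewrite neq_lt => /orP[h|h]; [right|left].
  apply: preimages_eq1_of_det_gt0 => // i.
  by rewrite -sgr_gt0 (Lsg i i0) sgr_gt0.
pose J : 'M[R]_2 := diag_mx (\row_j (-1) ^+ j).
have JE : \det J = -1.
  by rewrite det_diag big_ord_recl big_ord1 !mxE expr0 mul1r expr1.
have J0 : \det J != 0 by rewrite JE oppr_eq0 oner_eq0.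
have Junit : J \in unitmx by rewrite unitmxE unitfE.
have <- : preimages (fun i => J *m L i) (J *m v) = 1%N.
  apply: preimages_eq1_of_det_gt0 => //.
  - by move=> i; rewrite det_mulmx mulf_neq0.
  - by move=> i j x xi xj; rewrite -!mulmxA (Lagree i j).
  - move=> i; rewrite det_mulmx JE mulN1r oppr_gt0.
    by rewrite -sgr_lt0 (Lsg i i0) sgr_lt0.
  - by rewrite mulmx_neq0.
apply: eq_bigr => i _; congr (nat_of_bool (H i _)).
have Li : L i \in unitmx by rewrite unitmxE unitfE.
have JLi : J *m L i \in unitmx by rewrite unitmx_mul Junit.
have -> : J *m v = (J *m L i) *m (invmx (L i) *m v) by rewrite -mulmxA mulKVmx.
by rewrite mulKmx.
Qed.

End Decomposition.

(* The inverse agrees with [invmx (L i)] on the image of the closed set [C i],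
   and finitely many such images cover the target. *)
Lemma piecewise_linear_inverse (R : realType) (n : nat) (C : 'I_n -> set 'cV[R]_2)
    (L : 'I_n -> 'M[R]_2) (G H : 'cV[R]_2 -> 'cV[R]_2) :
  (forall i, closed (C i)) -> (forall x, exists i, C i x) ->
  (forall i x, C i x -> G x = L i *m x) -> (forall i, \det (L i) != 0) ->
  cancel G H -> cancel H G -> piecewise_linear H.
Proof.
move=> Ccl cover GL L0 GK HK.
have Lu i : L i \in unitmx by rewrite unitmxE unitfE.
have HC v i : C i (H v) -> H v = invmx (L i) *m v.
  by move=> Ci; rewrite -[v in RHS]HK (GL i) // mulKmx.
split; last first.
  exists n, (fun i => invmx (L i)) => v.
  by have [i Ci] := cover (H v); exists i; exact: HC.
move=> /= v P HvP.
have near_i i : \forall w \near v, C i (invmx (L i) *m w) -> P (invmx (L i) *m w).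
  have ci := @mulmx_continuous R (invmx (L i)) v.
  (* Inside [C i], continuity of the inverse matrix applies; outside, the implication is vacuous
     near [v] because the complement is open. *)
  have [Cv|nCv] := pselect (C i (invmx (L i) *m v)).
    have HvE : H v = invmx (L i) *m v by rewrite -[RHS]GK (GL i) // mulKVmx.
    rewrite HvE in HvP.
    have : \forall w \near v, P (invmx (L i) *m w) by exact: ci HvP.
    by apply: filterS => w Pw _.
  have : \forall w \near v, (~` C i) (invmx (L i) *m w).
    by apply: ci; apply: open_nbhs_nbhs; split => //; exact: closed_openC.
  by apply: filterS => w nC /nC.
have : \forall w \near v, forall i,
    C i (invmx (L i) *m w) -> P (invmx (L i) *m w).
  exact: (@filter_forall _ 'I_n _ (nbhs v) _ near_i).
apply: filterS => w hw /=; have [i Ci] := cover (H w).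
by rewrite (HC w i Ci); apply: hw; rewrite -HC.
Qed.

(** * Assembling the inverse *)

Theorem theorem4p5 (R : realType) (n : nat) (C : 'I_n -> set 'cV[R]_2)
    (L : 'I_n -> 'M[R]_2) (G : 'cV[R]_2 -> 'cV[R]_2)
    (HG : nondegenerate_strongly_piecewise_linear C L G)
    (Hn : [\/ n = 1%N, n = 2%N | n = 3%N] \/
          (n = 4%N /\ forall i, convex_set (C i))) :
  exists H : 'cV[R]_2 -> 'cV[R]_2,
    [/\ cancel G H, cancel H G & piecewise_linear H].
Proof.
case: HG => _ [Ccone Ccover Cdisj] GL L0 Lsg.
have Lu i : L i \in unitmx by rewrite unitmxE unitfE.
have cover x : exists i, C i x.
  by have [i _ Ci] : (\bigcup_i C i) x by [rewrite Ccover]; exists i.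
(* A cone equal to the plane makes [G] linear; otherwise all cones are proper sectors. *)
have [[i CiT]|noT] := pselect (exists i, C i = setT).
  have GE x : G x = L i *m x by apply: GL; rewrite CiT.
  have GK : cancel G (mulmx (invmx (L i))) by move=> x; rewrite GE mulKmx.
  have HK : cancel (mulmx (invmx (L i))) G by move=> x; rewrite GE mulKVmx.
  exists (mulmx (invmx (L i))); split => //.
  apply: (@piecewise_linear_inverse _ 1 (fun=> setT) (fun=> L i) G) => //.
  by exists ord0.
have /choice[alpha /choice[beta CE]] : forall i, exists alpha beta : R,
    0 < beta - alpha < 2 * pi /\ C i = sector alpha beta.
  by move=> i; case: (Ccone i) => // CT; case: noT; exists i.
have width i : 0 < beta i - alpha i < 2 * pi by case: (CE i).
have {CE} CE i : C i = sector (alpha i) (beta i) by case: (CE i).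
have cover' x : exists i, sector (alpha i) (beta i) x.
  by have [i] := cover x; rewrite CE => ?; exists i.
have disj i j : i != j ->
    (sector (alpha i) (beta i))° `&` (sector (alpha j) (beta j))° = set0.
  by move=> ij; rewrite -!CE; exact: Cdisj.
have Hn' : [\/ n = 1%N, n = 2%N | n = 3%N] \/
    (n = 4%N /\ forall i, beta i - alpha i <= pi).
  case: Hn => [|[n4 cvx]]; first by left.
  by right; split => // i; apply: convex_sector_le_pi => //; rewrite -CE.
have agree i j x : sector (alpha i) (beta i) x -> sector (alpha j) (beta j) x ->
    L i *m x = L j *m x.
  by rewrite -!CE => xi xj; rewrite -(GL i) // (GL j).
have one v := @preimages_eq1 _ _ _ _ width cover' disj L v Hn' L0 Lsg agree.
have GarcE i x : x != 0 -> in_arc (alpha i) (beta i) x -> G x = L i *m x.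
  by move=> x0 ix; apply: GL; rewrite CE; exact: (arc_sector (width i) x0 ix).
have G_eq0 x : G x = 0 -> x = 0.
  have [i Ci] := cover x; rewrite (GL i) // => /(congr1 (mulmx (invmx (L i)))).
  by rewrite mulKmx // mulmx0.
have G0 : G 0 = 0 by have [i Ci] := cover 0; rewrite (GL i) // mulmx0.
(* Two points with the same nonzero value are both counted by [preimages] at that value; the count
   being 1, they lie in the same sector, where [G] is an invertible linear map. *)
have Ginj : injective G.
  move=> x y xy; have [x0|x0] := eqVneq x 0.
    by rewrite x0 (G_eq0 y) // -xy x0.
  have y0 : y != 0 by apply: contra_neq x0 => y0; apply: G_eq0; rewrite xy y0.
  have Gx0 : G x != 0 by apply: contra_neq x0; exact: G_eq0.
  have [i xi] := arc_ex width cover' x0; have [j yj] := arc_ex width cover' y0.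
  have := GarcE i x x0 xi; have := GarcE j y y0 yj; rewrite -xy => yE xE.
  have invx : invmx (L i) *m G x = x by rewrite xE mulKmx.
  have invy : invmx (L j) *m G x = y by rewrite yE mulKmx.
  have ij : i = j.
    by apply: (sum_bool_eq1_uniq (one _ Gx0)); rewrite ?invx ?invy.
  by rewrite -invx -invy ij.
(* A count of 1 provides a sector containing its candidate preimage. *)
have Gsurj v : exists x, G x = v.
  have [->|v0] := eqVneq v 0; first by exists 0.
  have [i vi] : exists i, in_arc (alpha i) (beta i) (invmx (L i) *m v).
    apply: contrapT => /forallNP none; have := one v v0.
    by rewrite /preimages big1 // => i _; rewrite (negbTE (introN idP (none i))).
  exists (invmx (L i) *m v); rewrite (GarcE i) ?mulKVmx //.
  by rewrite mulmx_neq0 // det_inv invr_neq0.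
have [H HK] := choice Gsurj.
have GK : cancel G H by move=> x; apply: Ginj; rewrite HK.
exists H; split => //; apply: (piecewise_linear_inverse (C := C) _ cover GL) => // i.
by rewrite CE; exact: sector_closed.
Qed.
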